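(* For each $n\ge1$, let $E_n$ be an equivalence relation on $\mathbb Q$ with exactly $n$ classes, each dense in $\mathbb Q$, let $<$ be the usual ordering of $\mathbb Q$, and let $G_n=\mathrm{Aut}(\langle\mathbb Q,<,E_n\rangle)$. Let $A_1,\dots,A_n$ enumerate $\mathbb Q/E_n$ and let $H_n=\mathrm{Aut}(\langle\mathbb Q,<,A_1,\dots,A_n\rangle)$, where each $A_i$ is viewed as a unary relation. Then $H_n$ is a finite-index clopen normal subgroup of $G_n$, and the natural action of $G_n$ on the finite discrete space $G_n/H_n$ is the universal minimal flow of $G_n$.
   Context: Automorphism groups carry the topology of pointwise convergence on $\mathbb Q$ (discrete). The universal minimal flow of a topological group $G$ is the unique (up to isomorphism) minimal compact $G$-flow (continuous action on a nonempty compact Hausdorff space with all orbits dense) admitting a continuous equivariant map onto every minimal $G$-flow. *)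

(* Defs.v *)
From HB Require Import structures.
From mathcomp Require Import all_boot all_order all_algebra.
From mathcomp Require Import all_classical.
From mathcomp Require Import reals topology.
From Corelib Require RelationClasses.

Set Implicit Arguments.
Unset Strict Implicit.
Unset Printing Implicit Defensive.

Import Order.TTheory GRing.Theory Num.Theory.
Local Open Scope classical_set_scope.

HB.mixin Record isTopologicalGroup G & Topological G & Group G := {
  mulg_continuous : continuous (fun p : G * G => (p.1 * p.2)%g);
  invg_continuous : continuous (fun g : G => (g^-1)%g)
}.

#[short(type="topologicalGroupType")]
HB.structure Definition TopologicalGroup :=
  {G of Topological G & Group G & isTopologicalGroup G}.

Section Subgroups.
Context {G : groupType}.

Definition is_subgroup (H : set G) : Prop := group_closed (mem H).

Definition is_normal_subgroup (H : set G) : Prop :=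
  is_subgroup H /\ forall g h : G, H h -> H (g * h * g^-1)%g.

Definition lcoset (H : set G) (g : G) : set G := [set (g * h)%g | h in H].

Definition lcosets (H : set G) : set (set G) := range (lcoset H).

Definition finite_index (H : set G) : Prop := finite_set (lcosets H).

Lemma lcosets_translate (H : set G) (g : G) (C : set G) :
  lcosets H C -> lcosets H [set (g * c)%g | c in C].
Proof.
move=> [k _ <-]; exists (g * k)%g => //; rewrite /lcoset.
apply/seteqP; split => [x [h Hh <-]|x [_ [h Hh <-] <-]].
  by exists (k * h)%g; [exists h|rewrite mulgA].
by exists h => //; rewrite mulgA.
Qed.

End Subgroups.

(* G/H with the discrete topology, and G acting on it by left translation.    *)
Definition coset_space (G : groupType) (H : set G) : topologicalType :=
  discrete_topology (lcosets H).

Definition coset_act (G : groupType) (H : set G) (g : G) (C : coset_space H) :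
    coset_space H :=
  exist _ [set (g * c)%g | c in \val C]
    (mem_set (lcosets_translate g (set_mem (valP C)))).

Section Flows.
Context {G : topologicalGroupType}.

Record is_flow (X : topologicalType) (act : G -> X -> X) : Prop := IsFlow {
  flow_act1 : forall x, act 1%g x = x;
  flow_actM : forall g h x, act (g * h)%g x = act g (act h x);
  flow_continuous : continuous (fun p : G * X => act p.1 p.2);
  flow_nonempty : [set: X] !=set0;
  flow_compact : compact [set: X];
  flow_hausdorff : hausdorff_space X
}.

Definition is_minimal_flow (X : topologicalType) (act : G -> X -> X) : Prop :=
  is_flow act /\ forall x, dense [set act g x | g in [set: G]].

Definition is_flow_map (X Y : topologicalType) (actX : G -> X -> X)
    (actY : G -> Y -> Y) (f : X -> Y) : Prop :=
  continuous f /\ forall g x, f (actX g x) = actY g (f x).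

Definition flow_isomorphic (X Y : topologicalType) (actX : G -> X -> X)
    (actY : G -> Y -> Y) : Prop :=
  exists f : X -> Y, exists g : Y -> X,
    [/\ is_flow_map actX actY f, is_flow_map actY actX g,
        cancel f g & cancel g f].

Definition maps_onto_minimal_flows (X : topologicalType) (act : G -> X -> X) :
    Prop :=
  forall (Y : topologicalType) (actY : G -> Y -> Y), is_minimal_flow actY ->
    exists f : X -> Y, is_flow_map act actY f /\ range f = [set: Y].

(* The last clause is the uniqueness that justifies "the" in "the universal
   minimal flow". *)
Definition is_universal_minimal_flow (X : topologicalType)
    (act : G -> X -> X) : Prop :=
  [/\ is_minimal_flow act, maps_onto_minimal_flows act &
      forall (Y : topologicalType) (actY : G -> Y -> Y),
        is_minimal_flow actY -> maps_onto_minimal_flows actY ->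
        flow_isomorphic act actY].

End Flows.

(* Permutations of T, with the topology of pointwise convergence for T
   discrete; the product is composition, (g * h) x = g (h x). *)
Definition sym (T : choiceType) : Type :=
  [set f : {ptws T -> discrete_topology T} | bijective f].

HB.instance Definition _ (T : choiceType) := Topological.on (sym T).

Section SymGroup.
Context {T : choiceType}.
Implicit Types f g h : sym T.

Definition sym_fun f : T -> T := \val f.

Coercion sym_fun : sym >-> Funclass.

Lemma sym_bij f : bijective f. Proof. exact: set_mem (valP f). Qed.

Lemma symP f g : f =1 g -> f = g.
Proof. by move=> fg; apply: val_inj; apply: funext. Qed.

Definition mk_sym (f : T -> T) (fbij : bijective f) : sym T :=
  exist _ (f : {ptws T -> discrete_topology T}) (mem_set fbij).

Lemma sym_inv_subproof f : {g : T -> T | cancel f g /\ cancel g f}.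
Proof. by apply: cid; case: (sym_bij f) => g fg gf; exists g. Qed.

Definition sym_one : sym T :=
  mk_sym (@Bijective _ _ id id (fun=> erefl) (fun=> erefl)).

Definition sym_mul f g : sym T := mk_sym (bij_comp (sym_bij f) (sym_bij g)).

Definition sym_inv f : sym T :=
  let: exist g (conj fg gf) := sym_inv_subproof f in mk_sym (Bijective gf fg).

Lemma sym_invK f : cancel (sym_inv f) f.
Proof. by rewrite /sym_inv; case: sym_inv_subproof => g [fg gf] x; exact: gf. Qed.

Lemma sym_funK f : cancel f (sym_inv f).
Proof. by rewrite /sym_inv; case: sym_inv_subproof => g [fg gf] x; exact: fg. Qed.

Fact sym_mulA : associative sym_mul. Proof. by move=> f g h; exact: symP. Qed.
Fact sym_mul1 : left_id sym_one sym_mul. Proof. by move=> f; exact: symP. Qed.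
Fact sym_1mul : right_id sym_one sym_mul. Proof. by move=> f; exact: symP. Qed.
Fact sym_mulV : left_inverse sym_one sym_inv sym_mul.
Proof. by move=> f; apply: symP => x; exact: sym_funK. Qed.
Fact sym_Vmul : right_inverse sym_one sym_inv sym_mul.
Proof. by move=> f; apply: symP => x; exact: sym_invK. Qed.

HB.instance Definition _ := isGroup.Build (sym T)
  sym_mulA sym_mul1 sym_1mul sym_mulV sym_Vmul.

Lemma nbhs_sym_eval f (x : T) : nbhs f [set g : sym T | g x = f x].
Proof.
pose ev (g : {ptws T -> discrete_topology T}) : discrete_topology T := g x.
have ev_cont : continuous ev by exact: (@proj_continuous T (fun=> _) x).
have : nbhs (ev (\val f)) [set ev (\val f)] by exact: discrete_set1.
by move=> /ev_cont/(@initial_continuous _ _ (fun g : sym T => \val g) f).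
Qed.

Lemma cvg_sym (F : set_system (sym T)) f : Filter F ->
  (forall x : T, F [set g : sym T | g x = f x]) -> F --> f.
Proof.
move=> FF Fev A [/= _ [[B oB <-] Bf] sBA].
apply: (filterS sBA).
suff valF : (\val g : {ptws T -> discrete_topology T}) @[g --> F] --> \val f.
  by apply: (valF B); exact: open_nbhs_nbhs.
apply/cvg_sup => x C [/= _ [[V oV <-] Vf] sVC].
apply: (filterS sVC) => /=; apply: filterS (Fev x) => g gx.
have {}gx : g x = f x := gx.
by change (V (g x)); rewrite gx.
Qed.

Fact sym_mul_continuous :
  continuous (fun p : sym T * sym T => (p.1 * p.2)%g).
Proof.
suff mulC (f g : sym T) : (p.1 * p.2)%g @[p --> (f, g)] --> (f * g)%g.
  by case=> f g; exact: mulC.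
apply: cvg_sym => x.
exists ([set f' : sym T | f' (g x) = f (g x)], [set g' : sym T | g' x = g x]).
  by split; exact: nbhs_sym_eval.
move=> -[f' g'] [f'P g'P].
change (f' (g' x) = f (g x)).
have -> : (g' : sym T) x = g x := g'P.
exact: f'P.
Qed.

Fact sym_inv_continuous : continuous (fun f : sym T => (f^-1)%g).
Proof.
suff invC f : (g^-1)%g @[g --> f] --> (f^-1)%g by move=> f; exact: invC.
have FI := fmap_filter (fun g : sym T => (g^-1)%g) (nbhs_filter f).
apply: (cvg_sym FI) => x.
change (nbhs f [set g : sym T | sym_inv g x = sym_inv f x]).
apply: filterS (nbhs_sym_eval f (sym_inv f x)) => g gP.
have {}gP : g (sym_inv f x) = x := etrans gP (sym_invK f x).
by change (sym_inv g x = sym_inv f x); rewrite -[X in sym_inv g X]gP; exact: sym_funK.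
Qed.

HB.instance Definition _ := isTopologicalGroup.Build (sym T)
  sym_mul_continuous sym_inv_continuous.

End SymGroup.

Definition subgroup_of (G : topologicalGroupType) (H : set G)
  (Hgroup : is_subgroup H) : Type := set_type H.

Section SubgroupTopologicalGroup.
Context {G : topologicalGroupType} {H : set G} {Hgroup : is_subgroup H}.
Local Notation K := (subgroup_of Hgroup).

HB.instance Definition _ := SubChoice.on K.
HB.instance Definition _ := Topological.copy K (set_type H).
HB.instance Definition _ := SubChoice_isSubGroup.Build G (mem H) K Hgroup.

Fact val_subgroup_continuous : continuous (\val : K -> G).
Proof. exact: initial_continuous. Qed.

Fact subgroup_mul_continuous : continuous (fun p : K * K => (p.1 * p.2)%g).
Proof.
apply: (@continuous_comp_initial _ _ _ (\val : K -> G)) => -[x y].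
have -> : \val \o (fun p : K * K => (p.1 * p.2)%g) =
    (fun q : G * G => (q.1 * q.2)%g) \o (fun p : K * K => (\val p.1, \val p.2)).
  by apply: funext => -[u v].
apply: continuous_comp; last exact: mulg_continuous.
by apply: cvg_pair; apply: continuous_comp;
  [exact: cvg_fst|exact: val_subgroup_continuous|exact: cvg_snd|
   exact: val_subgroup_continuous].
Qed.

Fact subgroup_inv_continuous : continuous (fun x : K => (x^-1)%g).
Proof.
apply: (@continuous_comp_initial _ _ _ (\val : K -> G)) => x.
have -> : \val \o (fun x : K => (x^-1)%g) = (fun g : G => (g^-1)%g) \o \val.
  by apply: funext => u.
apply: continuous_comp; first exact: val_subgroup_continuous.
exact: invg_continuous.
Qed.

HB.instance Definition _ := isTopologicalGroup.Build K
  subgroup_mul_continuous subgroup_inv_continuous.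

End SubgroupTopologicalGroup.

Definition classes (E : rat -> rat -> Prop) : set (set rat) :=
  range (fun x => [set y | E x y]).

(* Aut(<Q, <, E>) and Aut(<Q, <, A_1, ..., A_n>) inside the group of all
   permutations of Q. *)
Definition aut_E (E : rat -> rat -> Prop) : set (sym rat) :=
  [set g | {mono g : x y / (x < y)%R} /\ forall x y, E (g x) (g y) <-> E x y].

Definition aut_A (n : nat) (A : 'I_n -> set rat) : set (sym rat) :=
  [set g | {mono g : x y / (x < y)%R} /\ forall i x, A i (g x) <-> A i x].

Lemma aut_E_subgroup E : is_subgroup (aut_E E).
Proof.
split; first by apply/mem_set; split.
suff divC (g h : sym rat) : aut_E E g -> aut_E E h ->
    aut_E E (sym_mul g (sym_inv h)).
  by move=> g h /set_mem gE /set_mem hE; apply/mem_set; exact: divC.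
move=> [gm gE] [hm hE]; have hK := sym_invK h.
split=> x y; last first.
  apply: (iff_trans (gE (sym_inv h x) (sym_inv h y))).
  by rewrite -hE !hK.
have -> : ((x < y) = (h (sym_inv h x) < h (sym_inv h y)))%R by rewrite !hK.
by rewrite hm; exact: gm.
Qed.

Definition Gn (E : rat -> rat -> Prop) : topologicalGroupType :=
  subgroup_of (aut_E_subgroup E).

Definition Hn (n : nat) (E : rat -> rat -> Prop) (A : 'I_n -> set rat) :
    set (Gn E) :=
  [set g | aut_A A (\val g)].

Arguments Hn {n} E A.

(* Main.v *)
(* Idea: the universal minimal flow is G/H because H_n is extremely amenable,
   i.e. every compact flow has an H_n-fixed point y; then g H |-> g y is a flow
   map from the finite flow G_n/H_n, with closed invariant range.

   Extreme amenability comes from the Ramsey property of finite orders coloured by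
   the classes. If no point were fixed, compactness would give finitely many pairs
   (h_i, V_i) with h_i in H_n, the V_i covering the flow, and a neighbourhood U of 1
   such that h_i U V_i is disjoint from U V_i. Colour g by some i with g^-1 y0 in V_i:
   the Ramsey property, applied to the finite set {1, h_1^-1, ..., h_m^-1}, yields g
   and i such that g^-1 y0 and h_i g^-1 y0 both lie in U V_i, a contradiction. *)

Require Import Defs.
From HB Require Import structures.
From mathcomp Require Import all_boot all_order all_algebra.
From mathcomp Require Import all_classical.
From mathcomp Require Import reals topology.
From mathcomp Require Import lra.
From Corelib Require RelationClasses.

Set Implicit Arguments.
Unset Strict Implicit.
Unset Printing Implicit Defensive.

Import Order.TTheory GRing.Theory Num.Theory.
Local Open Scope classical_set_scope.

(** * Ramsey's theorem for increasing tuples of natural numbers *)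

Lemma strictly_increasing (f : nat -> nat) :
  (forall k, (f k < f k.+1)%N) -> {homo f : a b / (a < b)%N}.
Proof. move=> fS a b; exact: (homo_ltn ltn_trans fS). Qed.

Lemma infinitely_often_color (C : finType) (c : nat -> C) :
  exists i, forall N, exists2 k, (N <= k)%N & c k = i.
Proof.
apply: contrapT => /forallNP noti.
have /choice[B BP] : forall i, exists N, forall k, (N <= k)%N -> c k <> i.
  move=> i; have /existsNP[N /forall2NP NP] := noti i; exists N => k Nk.
  by case: (NP k).
(* If each colour [i] stopped occurring from [B i] on, the index [\max_i B i] would have no possible
   colour. *)
exact: (BP (c (\max_i B i)) _ (leq_bigmax (c (\max_i B i)))).
Qed.

Lemma color_constant_subsequence (C : finType) (c : nat -> C) :
  exists i, exists2 h : nat -> nat, {homo h : a b / (a < b)%N} &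
    forall k, c (h k) = i.
Proof.
have [i iP] := infinitely_often_color c.
have /choice[nxt nxtP] : forall N, exists k, (N <= k)%N /\ c k = i.
  by move=> N; have [k] := iP N; exists k.
pose h := fix h k := nxt (if k is k'.+1 then (h k').+1 else 0).
exists i; exists h; last by case=> [|k]; exact: (nxtP _).2.
by apply: strictly_increasing => k; have [] := nxtP (h k).+1.
Qed.

(** Induction on [r]. Iterating the induction hypothesis gives nested subsequences [e k] such that
    the colour of an increasing [r.+1]-tuple starting with [a k = e k 0] and continuing inside
    [e k.+1] depends on [k] only; the pigeonhole principle then makes that colour constant along
    some [h]. *)
Lemma infinite_ramsey (C : finType) (r : nat) (c : seq nat -> C) :
  exists2 f : nat -> nat, {homo f : a b / (a < b)%N} &
    exists i, forall s, sorted ltn s -> size s = r -> c (map f s) = i.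
Proof.
elim: r c => [|r IHr] c.
  by exists id => //; exists (c [::]) => -[].
pose tail_color (e : nat -> nat) s := c (e 0 :: map (e \o succn) s).
have /choice[phi phiP] (e : nat -> nat) : exists fi : (nat -> nat) * C,
    {homo fi.1 : a b / (a < b)%N} /\
    forall s, sorted ltn s -> size s = r -> tail_color e (map fi.1 s) = fi.2.
  by have [f fincr [i fi]] := IHr (tail_color e); exists (f, i).
pose e := fix e k := if k is k'.+1 then e k' \o succn \o (phi (e k')).1 else id.
have e_incr k : {homo e k : a b / (a < b)%N}.
  elim: k => [//|k IHk] a b ab.
  by apply: IHk; rewrite ltnS; exact: (phiP (e k)).1.
pose a k := e k 0.
have e_factor k l : (k < l)%N -> exists m, a l = e k.+1 m.
  suff eD d x : exists m, e (k.+1 + d) x = e k.+1 m.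
    move=> /subnKC kl; rewrite -kl; exact: eD.
  by elim: d x => [|d IHd] x; [rewrite addn0; exists x|rewrite addnS; exact: IHd].
have a_incr : {homo a : x y / (x < y)%N}.
  by apply: strictly_increasing => k; exact: e_incr.
have [i [h h_incr hi]] := color_constant_subsequence (fun k => (phi (e k)).2).
exists (a \o h) => [x y xy|]; first exact/a_incr/h_incr.
exists i => -[//|k s] /= ks [sr].
(* [v l] is the position of [a (h l)] in the subsequence [e (h k).+1]; for [l <= k] it is
   unconstrained. *)
have /choice[v vP] l : exists m, (k < l)%N -> a (h l) = e (h k).+1 m.
  have [kl|lk] := ltnP k l; last by exists 0.
  by have [m am] := e_factor _ _ (h_incr _ _ kl); exists m.
have /allP sk : all (ltn k) s by move: ks; rewrite path_sortedE; [case/andP|exact: ltn_trans].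
have -> : map (a \o h) s = map (e (h k) \o succn) (map (phi (e (h k))).1 (map v s)).
  by rewrite -!map_comp; apply/eq_in_map => l /sk kl; exact: vP.
rewrite -(hi k); apply: (phiP (e (h k))).2; last by rewrite size_map.
(* [v] increases on [s] because both [e (h k).+1] and [a \o h] are increasing. *)
rewrite sorted_map; apply: (sub_in_sorted (P := mem s)) (path_sorted ks); last exact/allP.
move=> x y xs ys xy /=; rewrite ltnNge; apply/negP => vyx.
have : (a (h x) < a (h y))%N by exact/a_incr/h_incr.
rewrite (vP _ (sk _ xs)) (vP _ (sk _ ys)) ltnNge => /negP; apply.
by move: vyx; rewrite leq_eqVlt => /predU1P[->|/(e_incr (h k).+1)/ltnW].
Qed.

(** * Homogeneity and the Ramsey property of the coloured rational order *)

Section ColoredRationals.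
Context {T : Type} (tp : rat -> T).

Definition all_colors_dense :=
  forall (x y : rat) t, (x < y)%R -> exists z, [/\ (x < z)%R, (z < y)%R & tp z = t].

Definition is_color_aut (g : rat -> rat) :=
  {mono g : x y / (x < y)%R} /\ forall x, tp (g x) = tp x.

Definition is_partial_iso (p : seq (rat * rat)) :=
  forall a b, a \in p -> b \in p ->
    (a.1 < b.1)%R = (a.2 < b.2)%R /\ tp a.1 = tp a.2.

(** Makes room for the image of a new point. Either list may be empty, whence the arbitrary [0] and
    the shifts by [1]. *)
Lemma gap_between (L U : seq rat) :
  (forall l u, l \in L -> u \in U -> (l < u)%R) ->
  exists a b : rat, [/\ (a < b)%R, {in L, forall l, l <= a}%R & {in U, forall u, b <= u}%R].
Proof.
move=> LU.
have [a [La aU]] : exists a : rat, {in L, forall l, l <= a}%R /\ {in U, forall u, a < u}%R.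
  elim: L LU => [_|l L IHL LU].
    elim: U => [|u U [a [_ aU]]]; first by exists 0%R.
    exists (Num.min a (u - 1)%R); split=> // v; rewrite inE => /predU1P[->|vU].
      by rewrite gt_min gtrBl ltr01 orbT.
    by rewrite gt_min aU.
  have [|a [La aU]] := IHL; first by move=> x u xL; apply: LU; rewrite inE xL orbT.
  exists (Num.max l a); split=> [x|u uU].
    by rewrite inE le_max => /predU1P[->|/La ->]; rewrite ?lexx ?orbT.
  by rewrite gt_max aU // LU // mem_head.
exists a; elim: U {LU} aU => [_|u U IHU aU]; first by exists (a + 1)%R; split; rewrite ?ltrDl.
have [|b [ab _ bU]] := IHU; first by move=> x xU; apply: aU; rewrite inE xU orbT.
exists (Num.min u b); split=> // [|x]; first by rewrite lt_min ab aU ?mem_head.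
by rewrite inE ge_min => /predU1P[->|/bU ->]; rewrite ?lexx ?orbT.
Qed.

Hypothesis tp_dense : all_colors_dense.

(** The forth step: images of points below [x] lie below images of points above [x], and density of
    the colour of [x] puts a new image between them. *)
Lemma partial_iso_extend p x : is_partial_iso p ->
  exists y, is_partial_iso ((x, y) :: p).
Proof.
move=> pP.
have [[y xyp]|xNp] := pselect (exists y, (x, y) \in p).
  by exists y => a b; rewrite !inE => /predU1P[->|ap] /predU1P[->|bp]; exact: pP.
pose L := [seq a.2 | a <- p & (a.1 < x)%R]; pose U := [seq a.2 | a <- p & (x < a.1)%R].
have [l u|a [b [ab La bU]]] := @gap_between L U.
  move=> /mapP[c +->] /mapP[d +->]; rewrite !mem_filter => /andP[cx cp] /andP[xd dp].
  by have [<- _] := pP _ _ cp dp; exact: lt_trans cx xd.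
have [y [ay yb tpy]] := tp_dense (tp x) ab.
have ltP c : c \in p -> ((c.1 < x) = (c.2 < y))%R /\ ((x < c.1) = (y < c.2))%R.
  move=> cp; case: (ltgtP c.1 x) => [cx|xc|c1x].
  - have cL : c.2 \in L by apply: map_f; rewrite mem_filter cx.
    have cy := le_lt_trans (La _ cL) ay.
    by rewrite cy; split=> //; rewrite ltNge (ltW cy).
  - have cU : c.2 \in U by apply: map_f; rewrite mem_filter xc.
    have yc := lt_le_trans yb (bU _ cU).
    by rewrite yc; split=> //; rewrite ltNge (ltW yc).
  - by case: xNp; exists c.2; rewrite -c1x -surjective_pairing.
exists y => c d; rewrite !inE => /predU1P[->|cp] /predU1P[->|dp] /=; last exact: pP.
- by rewrite !ltxx tpy.
- by have [_ ->] := ltP d dp; rewrite tpy.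
- by have [-> _] := ltP c cp; have [_ ->] := pP _ _ cp cp.
Qed.

Let swap (a : rat * rat) := (a.2, a.1).

Lemma partial_iso_swap p : is_partial_iso p -> is_partial_iso (map swap p).
Proof.
move=> pP _ _ /mapP[a ap ->] /mapP[b bp ->] /=.
by have [-> ->] := pP _ _ ap bp.
Qed.

(** The back step is the forth step applied to the inverse partial isomorphism. *)
Lemma partial_iso_extend_both p x : is_partial_iso p ->
  exists q, [/\ is_partial_iso q, {subset p <= q},
    exists y, (x, y) \in q & exists y, (y, x) \in q].
Proof.
move=> /(partial_iso_extend x)[y] /[dup] pP /partial_iso_swap/(partial_iso_extend x)[z].
move=> /partial_iso_swap /=; rewrite -map_comp map_id_in => [zP|[] //].
exists ((z, x) :: (x, y) :: p); split=> //.
- by move=> a ap; rewrite !inE ap !orbT.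
- by exists y; rewrite !inE eqxx orbT.
- by exists z; rewrite mem_head.
Qed.

(** Back-and-forth: along an enumeration of the rationals, [p] grows to a chain of finite partial
    isomorphisms whose union is the graph of an automorphism. *)
Lemma partial_iso_color_aut p : is_partial_iso p ->
  exists2 g : sym rat, is_color_aut g & forall a, a \in p -> g a.1 = a.2.
Proof.
move=> p_iso.
have /choice[ext extP] (qx : seq (rat * rat) * rat) : exists q, is_partial_iso qx.1 ->
    [/\ is_partial_iso q, {subset qx.1 <= q},
      exists y, (qx.2, y) \in q & exists y, (y, qx.2) \in q].
  have [/(partial_iso_extend_both qx.2)[q]|] := pselect (is_partial_iso qx.1).
    by exists q.
  by exists [::].
(* Stage [k] treats the rational coded by [k]; a [k] that codes none treats [0], which is
   harmless. *)
pose P := fix P k := if k is k'.+1 then ext (P k', odflt 0%R (unpickle k')) else p.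
pose dom k : rat := odflt 0%R (unpickle k).
have P_iso k : is_partial_iso (P k).
  by elim: k => [//|k Pk]; have [] := extP (P k, dom k) Pk.
have P_mono k l : (k <= l)%N -> {subset P k <= P l}.
  move=> /subnKC <-; elim: (l - k)%N => [|d IHd] a aP; first by rewrite addn0.
  by rewrite addnS; have [_ sub _ _] := extP (P (k + d)%N, dom (k + d)%N) (P_iso _); exact/sub/IHd.
have P_total x : (exists y k, (x, y) \in P k) /\ (exists y k, (y, x) \in P k).
  have := extP (P (pickle x), dom (pickle x)) (P_iso _).
  rewrite /dom /= pickleK /= => -[_ _ [y yP] [z zP]].
  by split; [exists y|exists z]; exists (pickle x).+1; rewrite /= pickleK.
have R_iso x y x' y' k l : (x, y) \in P k -> (x', y') \in P l ->
    (x < x')%R = (y < y')%R /\ tp x = tp y.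
  move=> /(P_mono _ _ (leq_maxl k l)) xP /(P_mono _ _ (leq_maxr k l)) x'P.
  exact: (P_iso _ _ _ xP x'P).
(* Totality of the order turns preservation of [<] into the facts that the union of the stages is
   single-valued and injective. *)
have eqr (x y : rat) : ((x < y) = false -> (y < x) = false -> x = y)%R by case: ltgtP.
have R_fun x y y' k l : (x, y) \in P k -> (x, y') \in P l -> y = y'.
  move=> xP x'P; apply: eqr; rewrite -?(R_iso _ _ _ _ _ _ xP x'P).1 ?ltxx //.
  by rewrite -(R_iso _ _ _ _ _ _ x'P xP).1 ltxx.
have R_inj x x' y k l : (x, y) \in P k -> (x', y) \in P l -> x = x'.
  move=> xP x'P; apply: eqr; rewrite ?(R_iso _ _ _ _ _ _ xP x'P).1 ?ltxx //.
  by rewrite (R_iso _ _ _ _ _ _ x'P xP).1 ltxx.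
have /choice[g gP] x := (P_total x).1.
have /choice[h hP] x := (P_total x).2.
have gbij : bijective g.
  exists h => x.
    by have [k xk] := gP x; have [l xl] := hP (g x); exact: R_inj xl xk.
  by have [k xk] := hP x; have [l xl] := gP (h x); exact: R_fun xl xk.
exists (mk_sym gbij).
  split=> [x y|x]; have [k xk] := gP x; last by have [_ ->] := R_iso _ _ _ _ _ _ xk xk.
  by have [l yl] := gP y; have [-> _] := R_iso _ _ _ _ _ _ xk yl.
move=> [x y] xyp; have [k xk] := gP x.
exact: R_fun xk (xyp : (x, y) \in P 0).
Qed.

(* The Ramsey property of finite coloured orders, from Ramsey's theorem for
   sets of indices: in each interval ]k, k+1[ pick one point q k t of every colour t;
   the increasing tuple of colours t_1, ..., t_r is realised by q k_1 t_1, ..., q k_r t_r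
   for all k_1 < ... < k_r. *)
Lemma color_aut_ramsey (C : finType) (c : sym rat -> C) (F : seq rat) (K : seq (sym rat)) :
  (forall k, k \in K -> is_color_aut (sym_fun k)) ->
  exists2 g : sym rat, is_color_aut g & exists i, forall k, k \in K ->
    exists2 h : sym rat, is_color_aut h & c h = i /\ {in F, forall x, h x = g (sym_fun k x)}.
Proof.
move=> KP.
have /choice[q' q'P] (kt : nat * T) : exists z : rat,
    [/\ kt.1%:R < z, z < kt.1.+1%:R & tp z = kt.2]%R.
  by apply: tp_dense; rewrite ltr_nat.
pose q k t := q' (k, t).
have q_tp k t : tp (q k t) = t by have [] := q'P (k, t).
have q_lt k l t u : (k < l)%N -> (q k t < q l u)%R.
  move=> kl; have [_ qk _] := q'P (k, t); have [ql _ _] := q'P (l, u).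
  by apply: lt_trans (qk) (le_lt_trans _ ql); rewrite ler_nat.
have realize (M : seq rat) (f : rat -> nat) :
    {in M &, forall x y, (x < y)%R -> (f x < f y)%N} ->
    exists2 g : sym rat, is_color_aut g & {in M, forall x, g x = q (f x) (tp x)}.
  move=> f_incr; pose p := [seq (x, q (f x) (tp x)) | x <- M].
  have [|g gP gp] := @partial_iso_color_aut p.
    move=> _ _ /mapP[x xM ->] /mapP[y yM ->] /=; split; last by rewrite q_tp.
    case: (ltgtP x y) => [xy|yx|->]; last by rewrite ltxx.
      by rewrite q_lt //; exact: f_incr.
    by rewrite ltNge ltW // q_lt //; exact: f_incr.
  by exists g => // x xM; exact: (gp _ (map_f _ xM)).
(* The list is sorted without repetition, so [index x (srt M)] is the rank of [x] in [M]. *)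
pose srt (M : seq rat) := sort <=%O (undup M).
have srt_lt M : sorted <%O (srt M) by rewrite sort_lt_sorted undup_uniq.
have mem_srt M : srt M =i M by move=> x; rewrite mem_sort mem_undup.
have index_incr M : {in srt M &, forall x y, (x < y)%R -> (index x (srt M) < index y (srt M))%N}.
  move=> x y xM yM; apply: contraTT; rewrite -leqNgt -leNgt.
  exact: (sorted_leq_index le_trans le_refl (sort_sorted le_total _)).
have sorted_srt_map (M N : seq rat) (f : rat -> rat) : {in srt M, forall x, f x \in srt N} ->
    {mono f : x y / (x < y)%R} ->
    sorted ltn [seq index (f x) (srt N) | x <- srt M].
  move=> fMN f_mono; rewrite sorted_map.
  apply: (sub_in_sorted (P := mem (srt M))) (srt_lt M); last exact/allP.
  by move=> x y xM yM xy; apply: index_incr; rewrite ?fMN ?f_mono.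
pose realizes (s : seq nat) (h : sym rat) := is_color_aut h /\
  {in srt F, forall x, h x = q (nth 0 s (index x (srt F))) (tp x)}.
(* [rho s] sends the points of [F] into the intervals numbered by [s], so [c (rho s)] colours index
   tuples. A malformed [s] gets the identity. *)
have /choice[rho rhoP] s : exists h, sorted ltn s -> size s = size (srt F) -> realizes s h.
  have [|Ns] := pselect (sorted ltn s /\ size s = size (srt F)); last first.
    by exists (sym_one : sym rat) => ? ?; case: Ns.
  move=> [s_sorted s_size].
  have [|h hP hF] := realize (srt F) (fun x => nth 0 s (index x (srt F))).
    move=> x y xF yF xy; apply: (sorted_ltn_nth ltn_trans) => //.
    - by rewrite inE s_size index_mem.
    - by rewrite inE s_size index_mem.
    - exact: index_incr.
  by exists h.
have [f f_incr [i fi]] := infinite_ramsey (size (srt F)) (fun s => c (rho s)).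
(* All these points are sent by [g] into intervals numbered by the homogeneous sequence [f]. If [s]
   lists the ranks in [L] of the [k]-images of [F], then [g \o k] agrees on [F] with
   [rho (map f s)], which is the required [h]. *)
pose L := [seq sym_fun k x | k <- K, x <- F].
have [|g gP gL] := realize (srt L) (fun x => f (index x (srt L))).
  by move=> x y xL yL xy; apply: f_incr; exact: index_incr.
exists g => //; exists i => k kK.
have [k_mono k_tp] := KP k kK.
have kL : {in srt F, forall x, sym_fun k x \in srt L}.
  by move=> x; rewrite !mem_srt => xF; exact: (allpairs_f (fun k : sym rat => k : rat -> rat)).
have s_sorted := sorted_srt_map F L (sym_fun k) kL k_mono.
set s := [seq _ | x <- _] in s_sorted.
have s_size : size s = size (srt F) by rewrite size_map.
have [||h_aut hF] := rhoP (map f s); rewrite ?size_map //.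
  by rewrite sorted_map; apply: sub_sorted s_sorted => x y; exact: f_incr.
exists (rho (map f s)) => //; split=> [|x xF]; first exact: fi.
rewrite -mem_srt in xF.
rewrite hF //= gL ?kL // k_tp (nth_map 0) ?s_size ?index_mem //.
by rewrite (nth_map 0%R) ?index_mem // nth_index.
Qed.

End ColoredRationals.

(** * Compactness and finiteness *)

Lemma compact_finite_subcover (Y : topologicalType) (V : Y -> set Y) :
  compact [set: Y] -> (forall y, nbhs y (V y)) ->
  exists s : seq Y, forall z, exists2 y, y \in s & V y z.
Proof.
move=> /compact_near_coveringP Ycov nbhsV.
(* The filter of properties shared by all large enough finite lists; the near-covering form of
   compactness along it yields one list that serves every point. *)
pose F : set_system (seq Y) := [set P | exists s : seq Y, forall s' : seq Y, {subset s <= s'} -> P s'].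
have FF : Filter F.
  split=> [|P Q [s sP] [t tQ]|P Q PQ [s sP]]; first by exists [::].
    by exists (s ++ t) => u st; split; [apply: sP|apply: tQ] => y yst;
      apply: st; rewrite mem_cat yst ?orbT.
  by exists s => t st; exact/PQ/sP.
have [|s sP] := Ycov _ F (fun s z => exists2 y, y \in s & V y z) FF.
  move=> y _; exists (V y, [set s | y \in s]).
    by split; [exact: nbhsV|exists [:: y] => s; apply; rewrite mem_head].
  by move=> [z s] [/= Vz ys]; exists y.
by exists s => z; exact: (sP s (fun _ => id) z).
Qed.

Lemma finite_surjective_injective (X : choiceType) (f : X -> X) :
  finite_set [set: X] -> (forall y, exists x, f x = y) -> injective f.
Proof.
move=> /finite_seqP[s sX] fsurj.
have sP x : x \in undup s by rewrite mem_undup; have : [set: X] x by []; rewrite sX.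
have map_uniq : uniq (map f (undup s)).
  apply: (leq_size_uniq (undup_uniq s)); last by rewrite size_map.
  by move=> y _; have [x <-] := fsurj y; exact: map_f.
move=> x y fxy; rewrite -(nth_index x (sP x)) -(nth_index x (sP y)); congr nth.
apply/eqP; rewrite -(nth_uniq (f x) _ _ map_uniq) ?size_map ?index_mem //.
by rewrite !(nth_map x) ?index_mem // !nth_index // fxy.
Qed.

Lemma discrete_continuous (X : discreteTopologicalType) (Y : topologicalType) (f : X -> Y) :
  continuous f.
Proof.
move=> x A fx; apply: (@filterS _ (nbhs x) _ [set x]); last exact: discrete_set1.
by move=> _ ->; exact: nbhs_singleton fx.
Qed.

(** * Fixed points of flows from a colouring property of the group *)

Section TopologicalGroups.
Context {G : topologicalGroupType}.
Implicit Types (H : set G) (g h k : G).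

Lemma subgroup1 H : is_subgroup H -> H 1%g.
Proof. by move=> [/set_mem]. Qed.

Lemma subgroup_div H g h : is_subgroup H -> H g -> H h -> H (g * h^-1)%g.
Proof. by move=> [_ Hdiv] /mem_set gH /mem_set hH; exact: (set_mem (Hdiv _ _ gH hH)). Qed.

Lemma subgroupV H g : is_subgroup H -> H g -> H g^-1%g.
Proof. by move=> HH Hg; rewrite -[g^-1%g]mul1g; apply: subgroup_div => //; exact: subgroup1. Qed.

Lemma subgroupM H g h : is_subgroup H -> H g -> H h -> H (g * h)%g.
Proof. by move=> HH Hg Hh; rewrite -[h]invgK; apply: subgroup_div => //; exact: subgroupV. Qed.

(** A combinatorial form of extreme amenability: some translate [g K] lies, up to right
    multiplication by elements of [U], in a single colour class. *)
Definition oscillation_stable H :=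
  forall U, nbhs (1%g : G) U ->
  forall (C : finType) (c : G -> C) (K : seq G), (forall k, k \in K -> H k) ->
  exists2 g, H g & exists i, forall k, k \in K ->
    exists2 h, H h & c h = i /\ U ((g * k)^-1 * h)%g.

Section Flow.
Context {Y : topologicalType} {act : G -> Y -> Y}.
Hypothesis Yflow : is_flow act.

Lemma flow_cvg g (y : Y) : act p.1 p.2 @[p --> (g, y)] --> act g y.
Proof. exact: (flow_continuous Yflow (x := (g, y))). Qed.

Lemma flow_act_cvg g (y : Y) : act g z @[z --> y] --> act g y.
Proof.
apply: (@cvg_comp _ _ _ (fun z => (g, z)) (fun p => act p.1 p.2)); last exact: flow_cvg.
by apply: cvg_pair; [exact: cvg_cst|exact: cvg_id].
Qed.

(** Disjoint neighbourhoods [A] of [y] and [B] of [act g y] exist; continuity of the action at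
    [(1, y)] gives [U], [V] with [U V] inside [A] and [g U V] inside [B]. *)
Lemma moved_point_nbhs g y : act g y <> y -> exists UV : set G * set Y,
  [/\ nbhs (1%g : G) UV.1, nbhs y UV.2 & forall u u' v v',
    UV.1 u -> UV.1 u' -> UV.2 v -> UV.2 v' -> act g (act u v) <> act u' v'].
Proof.
move=> gy.
have [A [B [Ay Bgy AB]]] : exists A, exists B, [/\ nbhs y A, nbhs (act g y) B & A `&` B = set0].
  apply: contrapT => noAB; apply: gy; apply/esym/(flow_hausdorff Yflow) => A B Ay Bgy.
  apply/set0P/negP => /eqP AB0; apply: noAB; exists A, B; split=> //.
have nA : nbhs (act 1%g y) A by rewrite flow_act1.
have [[U V] [/= nU nV] UVA] := flow_cvg nA.
have Bcont : act g (act p.1 p.2) @[p --> (1%g : G, y)] --> act g y.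
  apply: (@cvg_comp _ _ _ (fun p : G * Y => act p.1 p.2) (act g) _ (nbhs y)).
    by have := @flow_cvg 1%g y; rewrite flow_act1.
  exact: flow_act_cvg.
have [[U' V'] [/= nU' nV'] UVB] := Bcont B Bgy.
exists (U `&` U', V `&` V'); split; [exact: filterI|exact: filterI|].
move=> u u' v v' [_ U'u] [Uu' _] [_ V'v] [Vv' _] uv.
suff : (A `&` B) (act u' v') by rewrite AB.
split; first exact: (UVA (u', v')).
by rewrite -uv; exact: (UVB (u, v)).
Qed.

Lemma oscillation_stable_fixed_point H : is_subgroup H -> oscillation_stable H ->
  exists y, forall h, H h -> act h y = y.
Proof.
move=> HH Hstable; apply: contrapT => nofix.
have /choice[w wP] (y : Y) : exists w : G * (set G * set Y),
    [/\ H w.1, nbhs (1%g : G) w.2.1, nbhs y w.2.2 & forall u u' v v',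
    w.2.1 u -> w.2.1 u' -> w.2.2 v -> w.2.2 v' -> act w.1 (act u v) <> act u' v'].
  have [g gH gy] : exists2 g, H g & act g y <> y.
    apply: contrapT => nog; apply: nofix; exists y => h Hh.
    by apply: contrapT => hy; apply: nog; exists h.
  by have [UV [nU nV UVP]] := moved_point_nbhs gy; exists (g, UV).
have [|s sP] := @compact_finite_subcover Y (fun y => (w y).2.2) (flow_compact Yflow).
  by move=> y; have [] := wP y.
have [y0 _] := flow_nonempty Yflow.
have /choice[c cP] (g : G) : exists i : seq_sub s, (w (val i)).2.2 (act g^-1%g y0).
  by have [y ys Vy] := sP (act g^-1%g y0); exists (SeqSub ys).
pose U := [set u | forall i : seq_sub s, (w (val i)).2.1 u].
have nU : nbhs (1%g : G) U.
  by apply: filter_forall => i; have [] := wP (val i).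
(* The element [1] will put [g^-1 y0] into [U V_i], and the inverse of [h_i] will put [h_i g^-1 y0]
   there as well. *)
pose K := 1%g :: [seq (w y).1^-1%g | y <- s].
have [|g Hg [i iP]] := Hstable U nU _ c K.
  move=> k; rewrite inE => /predU1P[->|/mapP[y _ ->]]; first exact: subgroup1.
  by apply: subgroupV => //; have [] := wP y.
(* Take [u = (g * k)^-1 * h] and [v = h^-1 y0]: the colour [i] of [h] says that [v] lies in
   [V_i]. *)
have act_split k : k \in K -> exists2 u, (w (val i)).2.1 u &
    exists2 v, (w (val i)).2.2 v & act (g * k)^-1%g y0 = act u v.
  move=> /iP[h Hh [ch Uh]]; exists ((g * k)^-1 * h)%g; first exact: Uh.
  exists (act h^-1%g y0); first by rewrite -ch; exact: cP.
  by rewrite -flow_actM // mulgK.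
have [u Uu [v Vv uvE]] := act_split 1%g (mem_head _ _).
have [|u' Uu' [v' Vv' uvE']] := act_split (w (val i)).1^-1%g.
  rewrite inE; apply/orP; right; apply/mapP.
  by exists (val i) => //; exact: (valP i).
have [_ _ _ /(_ _ _ _ _ Uu Uu' Vv Vv')] := wP (val i); apply.
by rewrite -uvE -uvE' -flow_actM // mulg1 invgM invgK.
Qed.

End Flow.

(** * Cosets of an open subgroup and the flow on them *)

Lemma mem_lcoset H g k : lcoset H g k <-> H (g^-1 * k)%g.
Proof.
split=> [[h Hh <-]|Hgk]; first by rewrite mulKg.
by exists (g^-1 * k)%g; rewrite ?mulVKg.
Qed.

Lemma lcoset_eq H g k : is_subgroup H -> H (g^-1 * k)%g -> lcoset H g = lcoset H k.
Proof.
move=> HH gk; apply/seteqP; split=> x; rewrite !mem_lcoset => xH.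
  rewrite (_ : k^-1 * x = (g^-1 * k)^-1 * (g^-1 * x))%g; last first.
    by rewrite invgM invgK -mulgA mulVKg.
  by apply: subgroupM => //; exact: subgroupV.
rewrite (_ : g^-1 * x = (g^-1 * k) * (k^-1 * x))%g; last by rewrite -mulgA mulVKg.
exact: subgroupM.
Qed.

Lemma cvg_mulg (T : Type) (F : set_system T) {FF : Filter F} (f f' : T -> G) g g' :
  f @ F --> g -> f' @ F --> g' -> (f x * f' x)%g @[x --> F] --> (g * g')%g.
Proof.
move=> fg fg'.
apply: (@cvg_comp _ _ _ (fun x => (f x, f' x)) (fun p : G * G => p.1 * p.2)%g
  _ (nbhs (g, g'))); first exact: cvg_pair.
exact: (@mulg_continuous G (g, g')).
Qed.

(** If [g] is outside [H], its open coset [g H] is a neighbourhood of [g] that misses [H]. *)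
Lemma open_subgroup_closed H : is_subgroup H -> open H -> closed H.
Proof.
move=> HH Hop; rewrite -[H]setCK; apply: open_closedC; rewrite openE => g gH.
have gV : (g^-1 * k)%g @[k --> g] --> (1%g : G).
  rewrite -(mulVg g).
  by apply: cvg_mulg; [exact: cvg_cst|exact: cvg_id].
have : nbhs (1%g : G) H by apply: open_nbhs_nbhs; split=> //; exact: subgroup1.
move=> /gV gH1; apply: (@filterS _ (nbhs g) _ _ _ _ gH1) => k /= Hgk Hk; apply: gH.
rewrite (_ : g = k * (g^-1 * k)^-1)%g; last by rewrite invgM invgK mulVKg.
exact: subgroup_div.
Qed.

Section CosetFlow.
Context {H : set G}.
Hypothesis HH : is_subgroup H.
Implicit Types (C : coset_space H).

Definition coset_of (g : G) : coset_space H :=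
  exist _ (lcoset H g) (mem_set (ex_intro2 _ _ g I erefl)).

Lemma coset_of_surj C : exists g, C = coset_of g.
Proof. by case: C => C CP; have [g _ gC] := set_mem CP; exists g; exact: val_inj. Qed.

Lemma coset_act_of g k : coset_act g (coset_of k) = coset_of (g * k)%g.
Proof.
apply: val_inj => /=; apply/seteqP; split=> [_ [_ [h Hh <-] <-]|_ [h Hh <-]].
  by exists h; rewrite ?mulgA.
by exists (k * h)%g; [exists h|rewrite mulgA].
Qed.

Lemma coset_of_eq g k : H (g^-1 * k)%g -> coset_of g = coset_of k.
Proof. by move=> gk; apply: val_inj; exact: lcoset_eq. Qed.

Hypotheses (H_finite : finite_index H) (H_open : open H).

Lemma coset_space_finite : finite_set [set: coset_space H].
Proof.
rewrite (_ : setT = (\val : coset_space H -> set G) @^-1` lcosets H).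
  by apply: finite_preimage => // C D _ _; exact: val_inj.
by apply/seteqP; split=> // C _; exact: set_mem (valP C).
Qed.

(** The action is locally constant: since [H] is open, [k a H = g a H] for all [k] near [g]. *)
Lemma coset_act_continuous : continuous (fun p : G * coset_space H => coset_act p.1 p.2).
Proof.
move=> [g C]; have [a ->] := coset_of_surj C => A /= Aga.
have AC : A (coset_act g (coset_of a)) by exact: nbhs_singleton.
have conj_cvg : ((g * a)^-1 * (k * a))%g @[k --> g] --> (1%g : G).
  rewrite -[X in _ --> X](mulVg (g * a)%g).
  apply: cvg_mulg; first exact: cvg_cst.
  by apply: cvg_mulg; [exact: cvg_id|exact: cvg_cst].
have H1 : nbhs (1%g : G) H by apply: open_nbhs_nbhs; split=> //; exact: subgroup1.
exists ([set k | H ((g * a)^-1 * (k * a))%g], [set coset_of a]).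
  by split; [exact: conj_cvg|exact: discrete_set1].
move=> [k _] [/= Hk ->]; move: AC; rewrite !coset_act_of.
by rewrite (coset_of_eq Hk).
Qed.

Lemma coset_flow_minimal : is_minimal_flow (@coset_act G H).
Proof.
have act1 C : coset_act 1%g C = C.
  by have [g ->] := coset_of_surj C; rewrite coset_act_of mul1g.
split; first split=> //.
- by move=> g h C; have [k ->] := coset_of_surj C; rewrite !coset_act_of mulgA.
- exact: coset_act_continuous.
- by exists (coset_of 1%g).
- exact: finite_compact coset_space_finite.
- exact: discrete_hausdorff.
(* The action is transitive, so every orbit is the whole space. *)
move=> C U [D DU] _; exists D; split=> //.
have [g ->] := coset_of_surj C; have [k ->] := coset_of_surj D.
by exists (k * g^-1)%g => //; rewrite coset_act_of mulgVK.
Qed.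

Hypothesis H_fixed : forall (Y : topologicalType) (act : G -> Y -> Y),
  is_flow act -> exists y, forall h, H h -> act h y = y.

Lemma coset_flow_onto : maps_onto_minimal_flows (@coset_act G H).
Proof.
move=> Y act [Yflow Ymin]; have [y yH] := H_fixed Yflow.
have /choice[rep repP] := coset_of_surj.
pose f C := act (rep C) y.
(* The chosen representative is immaterial because [y] is fixed by [H]. *)
have fE g : f (coset_of g) = act g y.
  have Hg : H (g^-1 * rep (coset_of g))%g.
    apply/mem_lcoset; have /(congr1 val) /= -> := repP (coset_of g).
    by apply/mem_lcoset; rewrite mulVg; exact: subgroup1.
  by rewrite -[in RHS](yH _ Hg) -flow_actM // mulVKg.
exists f; split.
  split=> [|g C]; first exact: discrete_continuous.
  have [k ->] := coset_of_surj C.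
  by rewrite coset_act_of !fE flow_actM.
(* A closed range containing the dense orbit of [y] is everything. *)
have f_closed : closed (range f).
  apply: compact_closed (flow_hausdorff Yflow) _; apply: continuous_compact.
    by apply: continuous_subspaceT; exact: discrete_continuous.
  exact: finite_compact coset_space_finite.
apply/seteqP; split=> // z _; apply: f_closed => U Uz.
have [z' [Uz' [g _ gz']]] := Ymin y (interior U) (ex_intro _ z Uz) (open_interior U).
exists z'; split; last exact: interior_subset.
by exists (coset_of g); rewrite ?fE.
Qed.

(** For uniqueness, take flow maps [f] and [g] onto each other's spaces. The map [g \o f] is onto a
    finite set, hence injective, so [f] is invertible; its inverse factors through a discrete space
    and is thus continuous. *)
Lemma coset_flow_universal : is_universal_minimal_flow (@coset_act G H).
Proof.
split; [exact: coset_flow_minimal|exact: coset_flow_onto|].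
move=> Y act Ymin Yonto.
have [f [f_map f_onto]] := coset_flow_onto Ymin.
have [g [g_map g_onto]] := Yonto _ _ coset_flow_minimal.
have gf_onto C : exists D, g (f D) = C.
  have [z _ <-] : range g C by rewrite g_onto.
  by have [D _ <-] : range f z; [rewrite f_onto|exists D].
have gf_inj : injective (g \o f).
  apply: (finite_surjective_injective coset_space_finite) => C; exact: gf_onto.
have [k kP] := choice gf_onto.
have kgf C : k (g (f C)) = C by apply: gf_inj; exact: kP.
have fkg z : f (k (g z)) = z by have [C _ <-] : range f z; [rewrite f_onto|rewrite kgf].
exists f, (k \o g); split=> //; split.
  move=> z; apply: continuous_comp; first exact: g_map.1.
  exact: discrete_continuous.
by move=> h z; rewrite -[in LHS](fkg z) -f_map.2 /= kgf.
Qed.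

End CosetFlow.
End TopologicalGroups.

(** * Colouring the rationals by classes, and the subgroup that fixes all colours *)

Lemma rat_dense_interval (A : set rat^o) (x y : rat) : dense A -> (x < y)%R ->
  exists z, [/\ (x < z)%R, (z < y)%R & A z].
Proof.
move=> Adense xy; pose O : set rat^o := [set z | (x < z < y)%R].
have [||z [/andP[xz zy] Az]] := Adense O; last by exists z.
  by exists ((x + y) / 2%:R)%R; rewrite /O /= !midf_lt.
rewrite openE => z /andP[xz zy].
exists (Num.min (z - x) (y - z))%R; first by rewrite /= lt_min !subr_gt0 xz.
move=> w; rewrite /ball_ /= lt_min !ltr_norml /O /=.
by move=> /andP[/andP[_ wx] /andP[wy _]]; lra.
Qed.

Lemma class_index (n : nat) (E : rat -> rat -> Prop) (A : 'I_n -> set rat) :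
  RelationClasses.Equivalence E -> set_bij [set: 'I_n] (classes E) A ->
  exists tp : rat -> 'I_n,
    (forall x, A (tp x) = [set y | E x y]) /\ (forall i x, A i x <-> tp x = i).
Proof.
move=> [Erefl Esym Etrans] [Afun Ainj Asurj].
have /choice[tp tpP] (x : rat) : exists i, A i = [set y | E x y].
  by have [|i _ iE] := Asurj [set y | E x y]; [exists x|exists i].
exists tp; split=> // i x; split=> [Aix|<-]; last by rewrite tpP; exact: Erefl.
have [z _ zE] := Afun i I.
have {}Aix : E z x by move: Aix; rewrite -zE.
apply: Ainj; rewrite ?inE // tpP -zE; apply/seteqP; split=> y /= yE.
  exact: Etrans Aix yE.
exact: Etrans (Esym _ _ Aix) yE.
Qed.

Section ColorFixer.
Context {T : finType} {tp : rat -> T} {E : rat -> rat -> Prop}.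
Hypotheses (tp_dense : all_colors_dense tp) (tpE : forall x y, E x y <-> tp x = tp y).
Local Notation G := (Gn E).
Implicit Types g h k : G.

Definition ap g : rat -> rat := sym_fun (\val g).

Lemma apM g h x : ap (g * h)%g x = ap g (ap h x). Proof. by []. Qed.

Lemma apVK g : cancel (ap g) (ap g^-1%g).
Proof. by move=> x; rewrite -apM mulVg. Qed.

Lemma apKV g : cancel (ap g^-1%g) (ap g).
Proof. by move=> x; rewrite -apM mulgV. Qed.

Lemma ap_E g x y : tp x = tp y <-> tp (ap g x) = tp (ap g y).
Proof. by rewrite -!tpE; have [_ /(_ x y) ->] := set_mem (valP g). Qed.

Definition color_fixer : set G := [set g | forall x, tp (ap g x) = tp x].

Lemma color_fixer_subgroup : is_subgroup color_fixer.
Proof.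
split; first exact/mem_set.
move=> g h /set_mem gH /set_mem hH; apply/mem_set => x.
by rewrite apM gH -[in RHS](apKV h x) hH.
Qed.

Lemma color_fixer_normal : is_normal_subgroup color_fixer.
Proof.
split; first exact: color_fixer_subgroup.
move=> g h hH x; rewrite !apM -[in RHS](apKV g x).
exact: (ap_E g _ _).1 (hH _).
Qed.

Lemma nbhs_ap g x : nbhs g [set k | ap k x = ap g x].
Proof. exact: (val_subgroup_continuous (nbhs_sym_eval (\val g) x)). Qed.

(** The filter generated by pointwise stabilisers of finite sets converges to [1] among all
    permutations, by pointwise convergence. *)
Lemma nbhs1_stabilizer (U : set G) : nbhs (1%g : G) U ->
  exists F : seq rat, forall u : G, {in F, forall x, ap u x = x} -> U u.
Proof.
move=> [/= _ [[B oB <-] B1] BU].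
pose FF : set_system (sym rat) := [set P | exists F : seq rat, forall s : sym rat,
  {in F, forall x, s x = x} -> P s].
have filterFF : Filter FF.
  split=> [|P Q [s sP] [t tQ]|P Q PQ [s sP]]; first by exists [::].
    by exists (s ++ t) => u ust; split; [apply: sP|apply: tQ] => y yst;
      apply: ust; rewrite mem_cat yst ?orbT.
  by exists s => t st; exact/PQ/sP.
have FF1 : FF --> (1%g : sym rat).
  by apply: cvg_sym => x; exists [:: x] => s; apply; rewrite mem_head.
have [|F FB] := FF1 B; first exact: open_nbhs_nbhs.
by exists F => u uF; apply: BU; exact: FB.
Qed.

Lemma color_representative : exists r : T -> rat, cancel r tp.
Proof.
have /choice[r rP] (t : T) : exists x, tp x = t.
  by have [x [_ _ xt]] := tp_dense t (ltr01 : 0 < 1 :> rat)%R; exists x.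
by exists r.
Qed.

(** Elements of [G] permute the colours, so agreement with [g] on one representative of each of the
    finitely many colours forces the same action on colours. *)
Lemma color_fixer_open : open color_fixer.
Proof.
rewrite openE => g gH.
have [r rP] := color_representative.
have : nbhs g [set k | forall t, ap k (r t) = ap g (r t)].
  exact: filter_forall (fun t => nbhs_ap g (r t)).
move=> /(@filterS _ (nbhs g)); apply => k kg x.
by rewrite -[RHS]rP -[RHS]gH -kg; apply: (ap_E k _ _).1; rewrite rP.
Qed.

(** A coset consists of all elements inducing a given self-map [s] of the finite set of colours. *)
Lemma color_fixer_finite_index : finite_index color_fixer.
Proof.
pose coset (s : {ffun T -> T}) : set G := [set k | forall x, tp (ap k x) = s (tp x)].
apply: (@sub_finite_set _ _ (range coset)); last exact/finite_image/finite_finset.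
move=> _ [g _ <-].
have [r rP] := color_representative.
pose s := [ffun t => tp (ap g (r t))].
have sE x : s (tp x) = tp (ap g x) by rewrite ffunE; apply: (ap_E g _ _).1; rewrite rP.
exists s => //; apply/seteqP; split=> k; rewrite mem_lcoset => kP x.
  by apply: (ap_E g _ _).2; rewrite -apM mulVKg kP sE.
by rewrite sE -[k](mulVKg g) apM; exact: (ap_E g _ _).1 (kP x).
Qed.

(** Shrink [U] to the stabiliser of a finite [F]. The Ramsey property makes [h] agree with [g * k]
    on [F], so [(g * k)^-1 * h] fixes [F] pointwise. *)
Lemma color_fixer_oscillation_stable : oscillation_stable color_fixer.
Proof.
move=> U /nbhs1_stabilizer[F FU] C c K KH.
have aut (s : sym rat) : is_color_aut tp s -> aut_E E s.
  by move=> [s_mono s_tp]; split=> // x y; rewrite !tpE !s_tp.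
(* The default [1] is taken only outside [aut_E E], hence never at a colour automorphism. *)
pose lift (s : sym rat) : G := insubd 1%g s.
have liftK (s : sym rat) : is_color_aut tp s -> \val (lift s) = s.
  by move=> /aut/mem_set; exact: insubdK.
have [|g gP [i iP]] := @color_aut_ramsey _ tp tp_dense _ (c \o lift) F (map \val K).
  move=> _ /mapP[k kK ->]; split; last exact: KH.
  by have [] := set_mem (valP k).
exists (lift g); first by move=> x; rewrite /ap liftK //; exact: gP.2.
exists i => k kK; have [h hP [ch hF]] := iP _ (map_f _ kK).
exists (lift h); first by move=> x; rewrite /ap liftK //; exact: hP.2.
split=> //; apply: FU => x xF; rewrite apM.
have -> : ap (lift h) x = ap (lift g * k)%g x.
  by rewrite apM /ap !liftK // hF.
exact: apVK.
Qed.

End ColorFixer.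

Theorem theorem8p4 (n : nat) (n_ge1 : (1 <= n)%N)
  (E : rat -> rat -> Prop) (E_equiv : RelationClasses.Equivalence E)
  (E_classes : (classes E #= `I_n)%card)
  (E_dense : forall C : set rat^o, classes E C -> dense C)
  (A : 'I_n -> set rat) (A_enum : set_bij [set: 'I_n] (classes E) A) :
  aut_A A `<=` aut_E E /\
  is_normal_subgroup (Hn E A) /\
  finite_index (Hn E A) /\
  clopen (Hn E A) /\
  is_universal_minimal_flow (@coset_act (Gn E) (Hn E A)).
Proof.
have [tp [tpE tpA]] := class_index E_equiv A_enum.
have Etp x y : E x y <-> tp x = tp y.
  have -> : E x y = A (tp x) y by rewrite tpE.
  by rewrite tpA; split.
have tp_dense : all_colors_dense tp.
  move=> x y i xy; have [Afun _ _] := A_enum.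
  have [z [xz zy /tpA Az]] := rat_dense_interval (E_dense _ (Afun i I)) xy.
  by exists z.
(* Preserving each [A i] means preserving [tp]; monotonicity comes from membership in [Gn E]. *)
have HnE : Hn E A = @color_fixer _ tp E.
  apply/seteqP; split=> g.
    by move=> [_ gA] x; apply/tpA/gA/tpA.
  move=> gH; split; first by have [] := set_mem (valP g).
  by move=> i x; rewrite !tpA -[tp x]gH.
rewrite HnE; split.
  move=> g [g_mono gA]; split=> // x y; rewrite !Etp.
  suff g_tp z : tp (g z) = tp z by rewrite !g_tp.
  by apply/tpA/gA/tpA.
have H_sub := @color_fixer_subgroup _ tp E.
have H_open := color_fixer_open tp_dense Etp.
have H_fin := color_fixer_finite_index tp_dense Etp.
split; first exact: color_fixer_normal.
split; first exact: H_fin.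
split; first by split=> //; exact: open_subgroup_closed.
apply: coset_flow_universal => // Y act Yflow.
exact: (oscillation_stable_fixed_point Yflow H_sub (color_fixer_oscillation_stable tp_dense Etp)).
Qed.
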